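(* Let $A\in\mathbb{C}^{m\times n}$ be a nonzero matrix of rank $r>0$ with singular value decomposition $$A=U\begin{bmatrix}\Sigma&0\\ 0&0\end{bmatrix}V^*,$$ where $U\in\mathbb{C}^{m\times m}$ and $V\in\mathbb{C}^{n\times n}$ are unitary and $\Sigma=\mathrm{diag}(\sigma_1,\dots,\sigma_r)$ with $\sigma_1\ge\sigma_2\ge\cdots\ge\sigma_r>0$ the singular values of $A$. Let $$E=V\begin{bmatrix} E_1 & E_2 \\ E_3 & E_4 \end{bmatrix}V^*\in\mathbb{C}^{n\times n},\qquad F=U\begin{bmatrix} F_1 & F_2 \\ F_3 & F_4 \end{bmatrix}U^*\in\mathbb{C}^{m\times m},$$ where $E_1,F_1\in\mathbb{C}^{r\times r}$ and the other blocks have the corresponding sizes. Then the following statements are equivalent: (a) $A^{(E,F)}$ exists; (b) $E_1^2=E_1$, $F_1^2=F_1$, $\Sigma E_1=F_1\Sigma$, $E_3E_1=E_3$, $F_1F_2=F_2$, $E_2=0$, $E_4=0$, $F_3=0$, and $F_4=0$; (c) $E_1^2=E_1$, $F_1^2=F_1$, $\Sigma E_1=F_1\Sigma$, $\mathcal{N}(E_1)\subseteq\mathcal{N}(E_3)$, $\mathcal{R}(F_2)\subseteq\mathcal{R}(F_1)$, $E_2=0$, $E_4=0$, $F_3=0$, and $F_4=0$. In this case, $$A^{(E,F)}=V\begin{bmatrix} E_1\Sigma^{-1} & E_1\Sigma^{-1}F_2 \\ E_3\Sigma^{-1} & E_3\Sigma^{-1}F_2 \end{bmatrix}U^*.$$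
   Context: $\mathcal{R}(M)$ and $\mathcal{N}(M)$ denote the column space and null space of a matrix $M$; $M^*$ is the conjugate transpose. $EF$-inverse: for $A\in\mathbb{C}^{m\times n}$, $E\in\mathbb{C}^{n\times n}$, $F\in\mathbb{C}^{m\times m}$, an $EF$-inverse of $A$ is a matrix $X\in\mathbb{C}^{n\times m}$ with $XAX=X$, $XA=E$ and $AX=F$. When it exists it is unique and is denoted $A^{(E,F)}$. Blocks with zero rows or columns (when $r=m$ or $r=n$) are understood to be absent. *)

(* Defs.v *)
From HB Require Import structures.
From mathcomp Require Import all_boot all_order all_algebra.
From mathcomp Require Import classical_sets reals.
From mathcomp Require Export complex spectral.

Set Implicit Arguments.
Unset Strict Implicit.
Unset Printing Implicit Defensive.

Import GRing.Theory Num.Theory.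
Local Open Scope ring_scope.
Local Open Scope classical_set_scope.

(* MathComp's row-space calculus ([kermx], [<=%MS]) acts on row vectors; the
   null space and the column space of a matrix are sets of column vectors. *)
Definition nullspace (K : pzRingType) (m n : nat) (M : 'M[K]_(m, n)) :
    set 'cV[K]_n :=
  [set x | M *m x = 0].

Definition colspace (K : pzRingType) (m n : nat) (M : 'M[K]_(m, n)) :
    set 'cV[K]_m :=
  [set M *m x | x in [set: 'cV[K]_n]].

Definition EF_inverse (K : pzRingType) (m n : nat) (A : 'M[K]_(m, n))
    (E : 'M[K]_n) (F : 'M[K]_m) (X : 'M[K]_(n, m)) : Prop :=
  [/\ X *m A *m X = X, X *m A = E & A *m X = F].

(* Uniqueness of an EF-inverse: it legitimates the notation A^(E,F). *)
Lemma EF_inverse_uniq (K : pzRingType) (m n : nat) (A : 'M[K]_(m, n))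
    (E : 'M[K]_n) (F : 'M[K]_m) (X Y : 'M[K]_(n, m)) :
  EF_inverse A E F X -> EF_inverse A E F Y -> X = Y.
Proof.
move=> [XAX XA AX] [YAY YA AY].
by rewrite -XAX XA -YA -mulmxA AX -AY mulmxA YAY.
Qed.

Definition EF_invertible (K : pzRingType) (m n : nat) (A : 'M[K]_(m, n))
    (E : 'M[K]_n) (F : 'M[K]_m) : Prop :=
  exists X, EF_inverse A E F X.

Definition diag_of_real (R : rcfType) (r : nat) (sigma : 'I_r -> R) :
    'M[R[i]]_r :=
  diag_mx (\row_i real_complex R (sigma i)).

(* Main.v *)
Require Import Defs.
From mathcomp Require Import all_boot all_order all_algebra.
From mathcomp Require Import classical_sets reals.
Import GRing.Theory Num.Theory.
Local Open Scope ring_scope.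
Local Open Scope classical_set_scope.
Local Open Scope sesquilinear_scope.

(** The idea is to work in the singular bases.  There [A] becomes
    [block_mx Sigma 0 0 0] with [Sigma] invertible, while [E], [F] become
    their given block matrices, and being an EF-inverse is unaffected by such
    a change of bases ([EF_inverse_basis_change]).  If [Y] is the candidate
    inverse, with blocks [Y1 .. Y4], then [Y] times the block form of [A] is
    [block_mx (Y1 *m Sigma) 0 (Y3 *m Sigma) 0], and in the other order the
    product is [block_mx (Sigma *m Y1) (Sigma *m Y2) 0 0].  Equating these
    with [E] and [F] forces [E2], [E4], [F3], [F4] to vanish and, [Sigma]
    being invertible, determines [Y1], [Y2] and [Y3].  The remaining equation
    [Y *m A *m Y = Y] then says, block by block, that [E1] and [F1] are
    idempotents, that [E1] is a right unit for [E3] and [F1] a left unit for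
    [F2], and it determines [Y4].  Existence and the explicit formula thus
    come out of one computation ([EF_inverse_blockP]).

    The inclusions of null and column spaces restate the two unit identities:
    an idempotent [P] has the columns of [1%:M - P] in its null space, and
    fixes its column space pointwise. *)

Lemma eq_mulmx_delta (K : pzRingType) (m n : nat) (M N : 'M[K]_(m, n)) :
  (forall j, M *m delta_mx j (0 : 'I_1) = N *m delta_mx j 0) -> M = N.
Proof.
move=> eqMN; apply/matrixP => i j.
by have /colP/(_ i) := eqMN j; rewrite -!colE !mxE.
Qed.

(** Every vector of the form [x - P *m x] is killed by an idempotent [P], so
    a matrix [M] killing the null space of [P] cannot tell [P *m x] from
    [x]. *)
Lemma nullspace_idem_sub (K : pzRingType) (m n : nat) (P : 'M[K]_n)
    (M : 'M[K]_(m, n)) :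
  P *m P = P -> (nullspace P `<=` nullspace M <-> M *m P = M).
Proof.
move=> PP; split=> [sPM | MP x /= Px0]; last first.
  by rewrite /nullspace /= -MP -mulmxA Px0 mulmx0.
apply: eq_mulmx_delta => j; set x := delta_mx j 0.
suff /eqP : M *m (x - P *m x) = 0.
  by rewrite mulmxBr mulmxA subr_eq0 => /eqP.
by apply: sPM; rewrite /nullspace /= mulmxBr mulmxA PP subrr.
Qed.

Lemma colspace_idem_sub (K : pzRingType) (m n : nat) (P : 'M[K]_m)
    (M : 'M[K]_(m, n)) :
  P *m P = P -> (colspace M `<=` colspace P <-> P *m M = M).
Proof.
move=> PP; split=> [sMP | PM _ [x _ <-]]; last first.
  by exists (M *m x); rewrite // mulmxA PM.
apply: eq_mulmx_delta => j; rewrite -mulmxA.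
have [|y _ <-] := sMP (M *m delta_mx j 0); first by exists (delta_mx j 0).
by rewrite mulmxA PP.
Qed.

(** [E] lives on the source side of [A] and [F] on its target side, so each is
    conjugated by its own change of basis; the inner factors [invmx P *m P]
    and [invmx Q *m Q] then cancel in every product of the defining
    equations. *)
Lemma EF_inverse_basis_change (K : comUnitRingType) (m n : nat)
    (P : 'M[K]_m) (Q : 'M[K]_n) (B : 'M[K]_(m, n)) (E : 'M[K]_n)
    (F : 'M[K]_m) (Y : 'M[K]_(n, m)) :
  P \in unitmx -> Q \in unitmx ->
  EF_inverse (P *m B *m invmx Q) (Q *m E *m invmx Q) (P *m F *m invmx P)
             (Q *m Y *m invmx P)
  <-> EF_inverse B E F Y.
Proof.
move=> uP uQ.
have inj a b (S : 'M[K]_a) (T : 'M[K]_b) : S \in unitmx -> T \in unitmx ->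
    injective (fun M : 'M[K]_(a, b) => S *m M *m invmx T).
  move=> uS uT; apply: (can_inj (g := fun M => invmx S *m M *m T)) => M.
  by rewrite -!mulmxA mulVmx // mulmx1 mulKmx.
have YB : Q *m Y *m invmx P *m (P *m B *m invmx Q) = Q *m (Y *m B) *m invmx Q.
  by rewrite !mulmxA mulmxKV.
have BY : P *m B *m invmx Q *m (Q *m Y *m invmx P) = P *m (B *m Y) *m invmx P.
  by rewrite !mulmxA mulmxKV.
have YBY : Q *m (Y *m B) *m invmx Q *m (Q *m Y *m invmx P)
    = Q *m (Y *m B *m Y) *m invmx P.
  by rewrite !mulmxA mulmxKV.
rewrite /EF_inverse YB BY YBY; split=> [[e1 e2 e3] | [-> -> ->] //].
by split; [move/inj: e1 | move/inj: e2 | move/inj: e3]; apply.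
Qed.

(** The whole theorem in the singular bases: only the invertibility of the
    nonzero block [S] matters there, not that it is diagonal. *)
Lemma EF_inverse_blockP (K : comUnitRingType) (r p q : nat) (S : 'M[K]_r)
    (E1 : 'M[K]_r) (E2 : 'M[K]_(r, q)) (E3 : 'M[K]_(q, r)) (E4 : 'M[K]_q)
    (F1 : 'M[K]_r) (F2 : 'M[K]_(r, p)) (F3 : 'M[K]_(p, r)) (F4 : 'M[K]_p)
    (Y : 'M[K]_(r + q, r + p)) :
  S \in unitmx ->
  EF_inverse (block_mx S 0 0 0) (block_mx E1 E2 E3 E4)
             (block_mx F1 F2 F3 F4) Y
  <-> [/\ [/\ E1 *m E1 = E1, F1 *m F1 = F1 & S *m E1 = F1 *m S],
          E3 *m E1 = E3, F1 *m F2 = F2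
        & [/\ E2 = 0, E4 = 0, F3 = 0 & F4 = 0]]
      /\ Y = block_mx (E1 *m invmx S) (E1 *m invmx S *m F2)
                      (E3 *m invmx S) (E3 *m invmx S *m F2).
Proof.
move=> uS; split; last first.
  move=> [[[E11 F11 SE] E31 F12 [-> -> -> ->]] ->].
  have YS : block_mx (E1 *m invmx S) (E1 *m invmx S *m F2)
      (E3 *m invmx S) (E3 *m invmx S *m F2) *m block_mx S 0 0 (0 : 'M_(p, q))
      = block_mx E1 0 E3 0.
    by rewrite mulmx_block !mulmx0 !addr0 !mulmxKV.
  split=> //; first by rewrite YS mulmx_block !mul0mx !addr0 !mulmxA E11 E31.
  by rewrite mulmx_block !mul0mx !addr0 !mulmxA SE mulmxK // F12.
rewrite -[Y]submxK; set Y1 := ulsubmx Y; set Y2 := ursubmx Y.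
set Y3 := dlsubmx Y; set Y4 := drsubmx Y => -[].
rewrite !mulmx_block !(mulmx0, mul0mx, addr0).
move=> /eq_block_mx[Y11 Y12 Y31 Y32].
move=> /eq_block_mx[<- <- <- <-] /eq_block_mx[<- <- <- <-].
split; last by rewrite !mulmxK // !mulmxA Y12 Y32.
split; [split | | | by []].
- by rewrite mulmxA Y11.
- by rewrite -mulmxA (mulmxA Y1) Y11.
- by rewrite mulmxA.
- by rewrite mulmxA Y31.
- by rewrite -mulmxA (mulmxA Y1) Y12.
Qed.

Lemma unitmx_diag_of_real (R : rcfType) (r : nat) (sigma : 'I_r -> R) :
  (forall i, 0 < sigma i) -> diag_of_real sigma \in unitmx.
Proof.
move=> sigma_gt0; rewrite unitmxE det_diag unitfE; apply/prodf_neq0 => i _.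
by rewrite mxE fmorph_eq0 lt0r_neq0.
Qed.

Theorem theorem3p2 (R : realType) (r p q : nat)
    (A : 'M[R[i]]_(r + p, r + q))
    (U : 'M[R[i]]_(r + p)) (V : 'M[R[i]]_(r + q)) (sigma : 'I_r -> R)
    (E : 'M[R[i]]_(r + q)) (F : 'M[R[i]]_(r + p))
    (E1 : 'M[R[i]]_r) (E2 : 'M[R[i]]_(r, q))
    (E3 : 'M[R[i]]_(q, r)) (E4 : 'M[R[i]]_q)
    (F1 : 'M[R[i]]_r) (F2 : 'M[R[i]]_(r, p))
    (F3 : 'M[R[i]]_(p, r)) (F4 : 'M[R[i]]_p)
    (Sigma := diag_of_real sigma)
    (A_neq0 : A != 0)
    (r_gt0 : (0 < r)%N)
    (rankA : \rank A = r)
    (unitaryU : U \is unitarymx)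
    (unitaryV : V \is unitarymx)
    (sigma_noninc : forall i j : 'I_r, (i <= j)%N -> sigma j <= sigma i)
    (sigma_gt0 : forall i : 'I_r, 0 < sigma i)
    (svdA : A = U *m block_mx Sigma 0 0 0 *m V ^t* )
    (defE : E = V *m block_mx E1 E2 E3 E4 *m V ^t* )
    (defF : F = U *m block_mx F1 F2 F3 F4 *m U ^t* ) :
  [<-> EF_invertible A E F;
       [/\ [/\ E1 *m E1 = E1, F1 *m F1 = F1 & Sigma *m E1 = F1 *m Sigma],
           E3 *m E1 = E3, F1 *m F2 = F2
         & [/\ E2 = 0, E4 = 0, F3 = 0 & F4 = 0]];
       [/\ [/\ E1 *m E1 = E1, F1 *m F1 = F1 & Sigma *m E1 = F1 *m Sigma],
           nullspace E1 `<=` nullspace E3, colspace F2 `<=` colspace F1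
         & [/\ E2 = 0, E4 = 0, F3 = 0 & F4 = 0]]]
  /\ (EF_invertible A E F ->
      forall X : 'M[R[i]]_(r + q, r + p), EF_inverse A E F X ->
        X = V *m block_mx (E1 *m invmx Sigma) (E1 *m invmx Sigma *m F2)
                          (E3 *m invmx Sigma) (E3 *m invmx Sigma *m F2)
              *m U ^t* ).
Proof.
have uS : Sigma \in unitmx by apply: unitmx_diag_of_real.
have uU := unitarymx_unit unitaryU; have uV := unitarymx_unit unitaryV.
rewrite -(invmx_unitary unitaryV) in svdA defE.
rewrite -(invmx_unitary unitaryU) in defF *.
have EFP Y := iff_trans (EF_inverse_basis_change _ _ _ _ _ _
  (block_mx E1 E2 E3 E4) (block_mx F1 F2 F3 F4) Y uU uV)
  (EF_inverse_blockP _ _ _ _ _ E1 E2 E3 E4 F1 F2 F3 F4 Y uS).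
rewrite -svdA -defE -defF in EFP.
(* Every candidate [X] is thus of the form to which [EFP] applies. *)
have coordK X : X = V *m (invmx V *m X *m U) *m invmx U.
  by rewrite !mulmxA mulmxK // mulmxV // mul1mx.
split; last by move=> _ X; rewrite [X]coordK => /EFP[_ ->].
tfae.
- by move=> [X]; rewrite [X]coordK => /EFP[].
- move=> [[E11 F11 SE] E31 F12 blocks0]; split=> //.
  + by apply/nullspace_idem_sub.
  + by apply/colspace_idem_sub.
- move=> [[E11 F11 SE] /nullspace_idem_sub E31 /colspace_idem_sub F12 blocks0].
  eexists; apply/EFP; split; last reflexivity.
  by split=> //; [apply: E31 | apply: F12].
Qed.
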